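(* Let $n\geq 3$ and let the symmetric group $S_n$ act on $V=\mathbb{C}^n$ by its natural permutation representation, $\sigma e_i=e_{\sigma(i)}$ for the standard basis $e_1,\dots,e_n$. Then for every $a\in\mathbb{C}$, $$\mathcal{H}_{\kappa,t}=T(V)\# S_n[t]\big/\langle e_ie_j-e_je_i-a(e_i-e_j)t \mid 1\leq i<j\leq n\rangle$$ is a Lie orbifold algebra over $\mathbb{C}[t]$. Further, the algebras $\mathcal{H}_{\kappa,1}$ (obtained by setting $t=1$) are precisely the Drinfeld orbifold algebras for this action such that $\kappa^L$ is supported only on the identity.
   Context: For a finite group $G$ acting linearly on $V\cong\mathbb{C}^n$, $G$ acts on the tensor algebra $T(V)$ and the symmetric algebra $S(V)$ by algebra automorphisms, and the skew group algebra $R\#G$ ($R=T(V)$ or $S(V)$) is $R\otimes\mathbb{C}G$ with multiplication $(r\otimes g)(s\otimes h)=r\,(g\cdot s)\otimes gh$. A linear (resp. constant) $2$-cochain is $\alpha=\sum_{g\in G}\alpha_g g$ with each $\alpha_g:\bigwedge^2V\to V$ (resp. $\to\mathbb{C}$) linear; we write $\alpha(v,w)=\sum_g\alpha_g(v,w)\otimes g\in T(V)\#G$. The support of $\alpha$ is $\{g:\alpha_g\neq 0\}$. For $\kappa=\kappa^L+\kappa^C$ with $\kappa^L$ linear and $\kappa^C$ constant, set $\mathcal{H}_\kappa=T(V)\#G/\langle vw-wv-\kappa^L(v,w)-\kappa^C(v,w)\mid v,w\in V\rangle$. Filter $\mathcal H_\kappa$ by assigning elements of $V$ degree one and elements of $G$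 degree zero; $\mathcal{H}_\kappa$ is a Drinfeld orbifold algebra if its associated graded algebra is isomorphic to $S(V)\#G$ (as graded algebras). If $\mathcal H_\kappa$ is a Drinfeld orbifold algebra and $t$ is a formal parameter, $\mathcal{H}_{\kappa,t}:=T(V)\#G[t]/\langle vw-wv-\kappa^L(v,w)t-\kappa^C(v,w)t^2\mid v,w\in V\rangle$ is called a Drinfeld orbifold algebra over $\mathbb{C}[t]$; it is called a Lie orbifold algebra over $\mathbb{C}[t]$ if moreover $\kappa^L$ is supported only on the identity. In the displayed algebra, $\kappa^L(e_i,e_j)=a(e_i-e_j)\otimes 1$ and $\kappa^C=0$.
   Formalization: The ''precisely'' part is stated for nonzero κ^L supported only on the identity; with κ^L = 0 it fails, since there are Drinfeld orbifold algebras with κ^C ≠ 0 supported on 3-cycles. *)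

(* Defs.v *)
From HB Require Import structures.
From mathcomp Require Import all_boot all_order all_fingroup all_algebra.
Set Implicit Arguments. Unset Strict Implicit. Unset Printing Implicit Defensive.
Import GRing.Theory Num.Theory.
Local Open Scope ring_scope.

(* Concrete model of T(V)#S_n and S(V)#S_n for V = C^n with the natural
   permutation representation, sigma e_i = e_(sigma i).
   An element of T(V)#G is a formal linear combination (a list) of basis
   tensors  e_(w_1)...e_(w_k) (x) g,  w a word in 'I_n, g in 'S_n.
   Two lists represent the same element iff their coefficient functions agree. *)

Section SkewGroupAlgebra.
Variables (C : numClosedFieldType) (n : nat).

Definition elt := seq (C * (seq 'I_n * 'S_n)).

Definition coef (x : elt) (w : seq 'I_n) (g : 'S_n) : C :=
  \sum_(t <- x | (t.2.1 == w) && (t.2.2 == g)) t.1.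

(* coefficient of the monomial (multiset) w times g, in S(V)#G *)
Definition scoef (x : elt) (w : seq 'I_n) (g : 'S_n) : C :=
  \sum_(t <- x | perm_eq t.2.1 w && (t.2.2 == g)) t.1.

Definition teq (x y : elt) : Prop := forall w g, coef x w g = coef y w g.
Definition seq_S (x y : elt) : Prop := forall w g, scoef x w g = scoef y w g.

(* group law written as composition: (gcomp g h) i = g (h i) *)
Definition gcomp (g h : 'S_n) : 'S_n := (h * g)%g.

Definition eadd (x y : elt) : elt := x ++ y.
Definition escale (c : C) (x : elt) : elt := [seq (c * t.1, t.2) | t <- x].
Definition esub (x y : elt) : elt := eadd x (escale (-1) y).
Definition emul (x y : elt) : elt :=
  [seq (s.1 * t.1, (s.2.1 ++ map (fun i : 'I_n => s.2.2 i) t.2.1, gcomp s.2.2 t.2.2))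
  | s : C * (seq 'I_n * 'S_n) <- x, t : C * (seq 'I_n * 'S_n) <- y].
Definition ebasis (w : seq 'I_n) (g : 'S_n) : elt := [:: (1, (w, g))].
Definition eone : elt := ebasis [::] 1%g.
Definition esum (s : seq elt) : elt := flatten s.

Definition tdeg_le (d : nat) (x : elt) : Prop :=
  forall w g, (d < size w)%N -> coef x w g = 0.
(* F_(d-1), with F_(-1) = 0 *)
Definition tdeg_lt (d : nat) (x : elt) : Prop :=
  if d is d'.+1 then tdeg_le d' x else teq x [::].
Definition shom (d : nat) (y : elt) : Prop :=
  forall w g, size w != d -> scoef y w g = 0.

(* A cochain kappa = kappa^L + kappa^C is given by coefficients:
   kappa^L_g(e_i, e_j) = sum_k kL g i j k e_k,  kappa^C_g(e_i,e_j) = kC g i j. *)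
Definition alternating (kL : 'S_n -> 'I_n -> 'I_n -> 'I_n -> C)
  (kC : 'S_n -> 'I_n -> 'I_n -> C) : Prop :=
  (forall g i j k, kL g i j k = - kL g j i k) /\ (forall g i j, kC g i j = - kC g j i).

Definition kappa_elt kL kC (i j : 'I_n) : elt :=
  [seq (kL g i j k : C, ([:: k], g)) | g <- enum 'S_n, k <- enum 'I_n]
  ++ [seq (kC g i j : C, ([::], g)) | g <- enum 'S_n].

Definition relator kL kC (i j : 'I_n) : elt :=
  esub (esub (ebasis [:: i; j] 1%g) (ebasis [:: j; i] 1%g)) (kappa_elt kL kC i j).

Definition in_ideal kL kC (x : elt) : Prop :=
  exists s : seq (elt * ('I_n * 'I_n) * elt),
    teq x (esum [seq emul (emul p.1.1 (relator kL kC p.1.2.1 p.1.2.2)) p.2 | p <- s]).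

(* H_kappa is a Drinfeld orbifold algebra: gr H_kappa ~= S(V)#G as graded
   algebras.  A graded algebra isomorphism gr H_kappa -> S(V)#G is encoded by
   its composites psi d : F_d T(V)#G -> F_d H_kappa -> F_d H/F_(d-1) H -> (S(V)#G)_d:
   linear, with kernel exactly F_(d-1) T + I, onto (S(V)#G)_d, multiplicative
   and unital. *)
Definition DOA kL kC : Prop :=
  exists psi : nat -> elt -> elt,
     (forall d x, tdeg_le d x -> shom d (psi d x))
  /\ (forall d x y, tdeg_le d x -> tdeg_le d y ->
        seq_S (psi d (eadd x y)) (eadd (psi d x) (psi d y)))
  /\ (forall d c x, tdeg_le d x -> seq_S (psi d (escale c x)) (escale c (psi d x)))
  /\ (forall d x, tdeg_le d x ->
        (seq_S (psi d x) [::] <->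
         exists y z, [/\ tdeg_lt d y, in_ideal kL kC z & teq x (eadd y z)]))
  /\ (forall d y, shom d y -> exists x, tdeg_le d x /\ seq_S (psi d x) y)
  /\ (forall d e x y, tdeg_le d x -> tdeg_le e y ->
        seq_S (psi (d + e)%N (emul x y)) (emul (psi d x) (psi e y)))
  /\ seq_S (psi 0%N eone) eone.

Definition supp_id (kL : 'S_n -> 'I_n -> 'I_n -> 'I_n -> C) : Prop :=
  forall g, g != 1%g -> forall i j k, kL g i j k = 0.

Definition LieOrbifold kL kC : Prop := DOA kL kC /\ supp_id kL.

Definition kLa (a : C) (g : 'S_n) (i j k : 'I_n) : C :=
  if g == 1%g then a * ((k == i)%:R - (k == j)%:R) else 0.
Definition kC0 (g : 'S_n) (i j : 'I_n) : C := 0.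

End SkewGroupAlgebra.

(* Main.v *)
Require Import Defs.
From mathcomp Require Import all_boot all_order all_fingroup all_algebra.
From mathcomp Require Import ring.

(** The Lie bracket [e_i, e_j] = a (e_i - e_j) is realised on polynomials by the
    S_n-equivariant operators E_i = x_i - a * Euler, where Euler multiplies a
    homogeneous polynomial by its degree.  Applying a tensor to 1 through these
    operators kills the defining ideal and changes the symbol of a tensor only in
    lower degrees, which is the PBW property.

    Conversely, if gr H_kappa is isomorphic to S(V)#G, comparing dimensions in
    degrees 0 and 1 shows that the ideal contains no nonzero element of filtration
    degree at most 1.  Conjugates of the relators and the Jacobi combination of
    commutators [e_u, r_vw] reduce to such elements; the first give invariance of
    kappa, which forces kappa^L = a (e_i - e_j), and the second then forces
    kappa^C = 0 when a <> 0. *)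

Set Implicit Arguments. Unset Strict Implicit. Unset Printing Implicit Defensive.
Import GRing.Theory Num.Theory.
Local Open Scope ring_scope.

(** * Linear functionals on T(V)#G and its defining ideal *)

Section LinearFunctionals.
Variables (C : numClosedFieldType) (n : nat).
Notation word := (seq 'I_n).
Notation basis := (seq 'I_n * 'S_n)%type.
Notation elt := (elt C n).
Implicit Types (x y z : elt) (f : basis -> C) (b c : basis).

(** Lists have no normal form, so equality, degree and ideal membership are all tested dually, by
    evaluating functionals given on basis tensors. *)
Definition lin f x : C := \sum_(t <- x) t.1 * f t.2.

Definition mulb b c : basis :=
  (b.1 ++ map (fun i : 'I_n => b.2 i) c.1, gcomp b.2 c.2).

Definition delta b : basis -> C := fun c => (c == b)%:R.

Lemma eq_lin f1 f2 x : f1 =1 f2 -> lin f1 x = lin f2 x.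
Proof. by move=> E; apply: eq_bigr => t _; rewrite E. Qed.

Lemma lin_nil f : lin f [::] = 0.
Proof. by rewrite /lin big_nil. Qed.

Lemma lin_cons f t x : lin f (t :: x) = t.1 * f t.2 + lin f x.
Proof. by rewrite /lin big_cons. Qed.

Lemma lin_cat f x y : lin f (x ++ y) = lin f x + lin f y.
Proof. by rewrite /lin big_cat. Qed.

Lemma lin_add f x y : lin f (eadd x y) = lin f x + lin f y.
Proof. exact: lin_cat. Qed.

Lemma lin_scale f (a : C) x : lin f (escale a x) = a * lin f x.
Proof.
by rewrite /lin big_map big_distrr; apply: eq_bigr => t _ /=; rewrite mulrA.
Qed.

Lemma lin_sub f x y : lin f (esub x y) = lin f x - lin f y.
Proof. by rewrite lin_add lin_scale mulN1r. Qed.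

Lemma lin_basis f w g : lin f (ebasis C w g) = f (w, g).
Proof. by rewrite lin_cons lin_nil mul1r addr0. Qed.

Lemma lin_sum f (s : seq elt) : lin f (esum s) = \sum_(x <- s) lin f x.
Proof.
by elim: s => [|x s IH]; rewrite ?big_nil ?lin_nil //= lin_cat big_cons IH.
Qed.

Lemma lin_mul f x y :
  lin f (emul x y) = lin (fun b => lin (fun c => f (mulb b c)) y) x.
Proof.
rewrite /lin /emul big_allpairs_dep; apply: eq_bigr => s _ /=.
by rewrite big_distrr; apply: eq_bigr => t _ /=; rewrite mulrA.
Qed.

Lemma lin0 x : lin (fun=> 0) x = 0.
Proof. by rewrite /lin big1 // => t _; rewrite mulr0. Qed.

Lemma lin_exchange (F : basis -> basis -> C) x y :
  lin (fun b => lin (F b) y) x = lin (fun c => lin (F^~ c) x) y.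
Proof.
rewrite /lin; under eq_bigr do rewrite big_distrr; rewrite exchange_big /=.
apply: eq_bigr => t _; rewrite big_distrr /=.
by apply: eq_bigr => s _; rewrite mulrCA.
Qed.

Lemma coefE x w g : coef x w g = lin (delta (w, g)) x.
Proof.
rewrite /coef /lin big_mkcond; apply: eq_bigr => -[c [v h]] _ /=.
by rewrite /delta xpair_eqE; case: ifP; rewrite ?mulr1 ?mulr0.
Qed.

Lemma scoefE x w g :
  scoef x w g = lin (fun b => (perm_eq b.1 w && (b.2 == g))%:R) x.
Proof.
rewrite /scoef /lin big_mkcond; apply: eq_bigr => -[c [v h]] _ /=.
by case: ifP; rewrite ?mulr1 ?mulr0.
Qed.

(** The list [s] only has to contain the basis tensors of [x] on which [f] is nonzero, so the words
    of one fixed length suffice for an [f] vanishing on all others. *)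
Lemma lin_coef f x (s : seq basis) : uniq s ->
  (forall t, t \in x -> t.2 \notin s -> f t.2 = 0) ->
  lin f x = \sum_(b <- s) coef x b.1 b.2 * f b.
Proof.
move=> us fs; under eq_bigr => b _ do rewrite coefE -surjective_pairing.
rewrite /lin; under [RHS]eq_bigr do rewrite big_distrl.
rewrite exchange_big /= !big_seq; apply: eq_bigr => t tx.
have [ts|/[dup] nts /(fs t tx) ->] := boolP (t.2 \in s); last first.
  rewrite mulr0 big_seq big1 // => b bs; rewrite /delta.
  by case: eqP bs nts => [<- ->|_ _]; rewrite ?mulr0 ?mul0r.
rewrite (bigD1_seq t.2) //= /delta eqxx mulr1 big1 ?addr0 // => b.
by rewrite eq_sym => /negPf ->; rewrite mulr0 mul0r.
Qed.

(** Coefficients are the functionals [delta]; conversely every functional is a combination of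
    coefficients over the joint support of [x] and [y]. *)
Lemma teqP x y : teq x y <-> forall f, lin f x = lin f y.
Proof.
split=> [E f|E w g]; last by rewrite !coefE E.
have us := undup_uniq [seq t.2 | t <- x ++ y].
rewrite !(lin_coef us); first by apply: eq_bigr => b _; rewrite E.
  by move=> t ty; rewrite mem_undup map_f // mem_cat ty orbT.
by move=> t tx; rewrite mem_undup map_f // mem_cat tx.
Qed.

Lemma lin_filter f (p : pred basis) x :
  lin f [seq t <- x | p t.2] = lin (fun b => (p b)%:R * f b) x.
Proof.
rewrite /lin big_filter big_mkcond; apply: eq_bigr => t _.
by case: (p _); rewrite ?mul1r ?mul0r ?mulr0.
Qed.

(** The degree bound concerns coefficients, so longer words may occur in the list and cancel;
    truncating [f] above length [d] discards them. *)
Lemma lin_deg_le d f x : tdeg_le d x ->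
  lin f x = lin (fun b => (size b.1 <= d)%:R * f b) x.
Proof.
move=> dx; rewrite -(lin_filter f (fun b => size b.1 <= d)%N).
move: f; apply/teqP => w g; rewrite !coefE -coefE (lin_filter _ (fun b => size b.1 <= d)%N).
have [le|gt] := leqP (size w) d; last first.
  rewrite dx //; symmetry; rewrite -[RHS](lin0 x); apply: eq_lin => b.
  by rewrite /delta; case: eqP => [->|]; rewrite ?mulr0 //= leqNgt gt mul0r.
rewrite coefE; apply: eq_lin => b.
by rewrite /delta; case: eqP => [->|]; rewrite ?mulr0 //= le mul1r.
Qed.

Lemma tdeg_leP d x :
  (forall f, (forall b, (size b.1 <= d)%N -> f b = 0) -> lin f x = 0) <->
  tdeg_le d x.
Proof.
split=> [H w g dw|dx f f0]; last first.
  rewrite (lin_deg_le _ dx) -[RHS](lin0 x); apply: eq_lin => b.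
  by have [/f0->|_] := leqP; rewrite ?mulr0 ?mul0r.
rewrite coefE; apply: H => b; rewrite leqNgt /delta.
by case: eqP => // ->; rewrite dw.
Qed.

Lemma tdeg_ltP d x :
  (forall f, (forall b, (size b.1 < d)%N -> f b = 0) -> lin f x = 0) <->
  tdeg_lt d x.
Proof.
case: d => [|d]; last exact: tdeg_leP.
split=> [H|/teqP H f _]; last by rewrite H lin_nil.
by apply/teqP => f; rewrite H ?lin_nil.
Qed.

Lemma lin_kappa f kL kC i j : lin f (kappa_elt kL kC i j) =
  \sum_g (\sum_k kL g i j k * f ([:: k], g) + kC g i j * f ([::], g)).
Proof.
rewrite lin_cat big_split /lin big_allpairs_dep /=; congr (_ + _).
  by rewrite big_enum; apply: eq_bigr => g _; rewrite big_enum.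
by rewrite big_map big_enum.
Qed.

Lemma lin_relator f kL kC i j : lin f (relator kL kC i j) =
  f ([:: i; j], 1%g) - f ([:: j; i], 1%g) - lin f (kappa_elt kL kC i j).
Proof. by rewrite !lin_sub !lin_basis. Qed.

Lemma mulb1l b : mulb ([::], 1%g) b = b.
Proof.
case: b => w g; rewrite /mulb /gcomp /= mulg1; congr (_, _).
by rewrite -[RHS]map_id; apply: eq_map => i; rewrite perm1.
Qed.

Lemma mulb1r b : mulb b ([::], 1%g) = b.
Proof. by case: b => w g; rewrite /mulb /gcomp /= mul1g cats0. Qed.

Definition rel_mul kL kC (p : elt * ('I_n * 'I_n) * elt) : elt :=
  emul (emul p.1.1 (relator kL kC p.1.2.1 p.1.2.2)) p.2.

Lemma in_idealP kL kC x : in_ideal kL kC x <->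
  exists s, forall f, lin f x = \sum_(p <- s) lin f (rel_mul kL kC p).
Proof.
split=> -[s H]; exists s; last first.
  by apply/teqP => f; rewrite H lin_sum big_map.
by move=> f; move/teqP: H => ->; rewrite lin_sum big_map.
Qed.

Lemma in_ideal_teq kL kC x y : teq x y -> in_ideal kL kC x -> in_ideal kL kC y.
Proof.
move=> /teqP E /in_idealP[s H]; apply/in_idealP; exists s => f.
by rewrite -E.
Qed.

Lemma in_ideal0 kL kC : in_ideal kL kC ([::] : elt).
Proof. by exists [::]. Qed.

Lemma in_idealD kL kC x y :
  in_ideal kL kC x -> in_ideal kL kC y -> in_ideal kL kC (eadd x y).
Proof.
move=> /in_idealP[s H] /in_idealP[s' H']; apply/in_idealP.
by exists (s ++ s') => f; rewrite lin_add big_cat H H'.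
Qed.

Lemma in_idealZ kL kC (a : C) x : in_ideal kL kC x -> in_ideal kL kC (escale a x).
Proof.
move=> /in_idealP[s H]; apply/in_idealP.
exists [seq (escale a p.1.1, p.1.2, p.2) | p <- s] => f.
rewrite lin_scale H big_map big_distrr; apply: eq_bigr => p _ /=.
by rewrite !lin_mul lin_scale.
Qed.

Lemma in_ideal_sum kL kC (I : Type) (r : seq I) (F : I -> elt) :
  (forall i, in_ideal kL kC (F i)) -> in_ideal kL kC (esum (map F r)).
Proof.
move=> FI; elim: r => [|i r IH]; first exact: in_ideal0.
exact: in_idealD (FI i) IH.
Qed.

Lemma in_ideal_rel kL kC x i j y :
  in_ideal kL kC (emul (emul x (relator kL kC i j)) y).
Proof.
by apply/in_idealP; exists [:: (x, (i, j), y)] => f; rewrite big_seq1.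
Qed.

Lemma lin_rel_basis f b kL kC i j c :
  lin f (emul (emul (ebasis C b.1 b.2) (relator kL kC i j)) (ebasis C c.1 c.2)) =
  lin (fun r => f (mulb (mulb b r) c)) (relator kL kC i j).
Proof.
rewrite !lin_mul lin_basis -!surjective_pairing.
by apply: eq_lin => r; rewrite lin_basis -surjective_pairing.
Qed.

(** By bilinearity it is enough to multiply each relator by single basis tensors on both sides. *)
Lemma in_ideal_lin0 kL kC f x :
  (forall i j b c, lin (fun r => f (mulb (mulb b r) c)) (relator kL kC i j) = 0) ->
  in_ideal kL kC x -> lin f x = 0.
Proof.
move=> H /in_idealP[s ->]; rewrite big1 // => -[[y [i j]] z] _ /=.
rewrite /rel_mul /= !lin_mul -[RHS](lin0 y); apply: eq_lin => b.
by rewrite lin_exchange -[RHS](lin0 z); apply: eq_lin => c; rewrite H.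
Qed.

End LinearFunctionals.

(** * The operators [E_i] and the PBW property for [kLa] *)

Section PBW.
Variables (C : numClosedFieldType) (n : nat) (a : C).
Notation word := (seq 'I_n).
Notation basis := (seq 'I_n * 'S_n)%type.
Notation elt := (elt C n).
Implicit Types (x y z : elt) (b c : basis) (m u v w : word).

(* The coefficient of the monomial [m] in [E_(w_1) ... E_(w_k) 1], where
   [E_i := x_i - a * Euler] acts on the polynomial ring. *)
Fixpoint phi m w : C :=
  if w is i :: w' then
    (if i \in m then phi (rem i m) w' else 0) - a * (size m)%:R * phi m w'
  else (m == [::])%:R.

Lemma rem_rem (T : eqType) (i j : T) (s : seq T) :
  rem i (rem j s) = rem j (rem i s).
Proof.
elim: s => //= k s IH; have [->|kj] := eqVneq k j.
  have [->|ji] /= := eqVneq j i; first by [].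
  by rewrite eqxx.
by have [->|ki] /= := eqVneq k i; rewrite ?eqxx // (negPf kj) (negPf ki) IH.
Qed.

Lemma mem_remC (T : eqType) (i j : T) (s : seq T) :
  (i \in s) && (j \in rem i s) = (j \in s) && (i \in rem j s).
Proof.
have [->//|ij] := eqVneq i j.
have E (k l : T) : k != l -> (k \in rem l s) = (k \in s).
  move=> kl; have [ls|] := boolP (l \in s); last by move=> /rem_id ->.
  by rewrite (perm_mem (perm_to_rem ls)) in_cons (negPf kl).
by rewrite !E // 1?eq_sym // andbC.
Qed.

(** This is [E_i, E_j] = a (E_i - E_j) in coefficients: [Euler, x_i] = x_i appears as the drop of
    [size m] by one when a letter is removed. *)
Lemma phi_swap m i j v :
  phi m (i :: j :: v) - phi m (j :: i :: v) = a * (phi m (i :: v) - phi m (j :: v)).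
Proof.
rewrite /=.
have sz k : k \in m -> (size m)%:R = (size (rem k m))%:R + 1 :> C.
  by move=> km; rewrite (perm_size (perm_to_rem km)) /= -natr1.
have := mem_remC i j m; rewrite (rem_rem j i).
have [im|_] := boolP (i \in m); have [jm|_] := boolP (j \in m) => /=.
- move=> ->; have := sz _ im; rewrite (sz _ jm) => /addIr ->.
  by case: ifP => _; ring.
- by move=> ->; rewrite (sz _ im); ring.
- by move=> <-; rewrite (sz _ jm); ring.
- by move=> _; ring.
Qed.

Lemma phi_rel m u i j v :
  phi m (u ++ i :: j :: v) - phi m (u ++ j :: i :: v) =
  a * (phi m (u ++ i :: v) - phi m (u ++ j :: v)).
Proof.
elim: u m => [|k u IH] m; first exact: phi_swap.
have rearr (p q r s c : C) : (p - c * r) - (q - c * s) = (p - q) - c * (r - s).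
  by ring.
rewrite !cat_cons [LHS]rearr [in RHS]rearr -/phi IH.
by case: ifP => _; rewrite ?IH; ring.
Qed.

Lemma phi_small m w : (size w < size m)%N -> phi m w = 0.
Proof.
elim: w m => [|i w IH] m /=; first by case: m.
move=> lt; rewrite (IH m) ?(ltnW lt) // mulr0 subr0; case: ifP => // im.
by rewrite IH // size_rem // -ltnS prednK // (leq_trans _ lt).
Qed.

(** The Euler terms do not raise the degree, so the leading term of E_(w_1) ... E_(w_k) 1 is the
    commutative monomial of [w]. *)
Lemma phi_top m w : size w = size m -> phi m w = (perm_eq w m)%:R.
Proof.
elim: w m => [|i w IH] m /=; first by case: m.
move=> sm; rewrite (@phi_small m) -?sm // mulr0 subr0; case: ifP => im.
  rewrite IH; last by rewrite size_rem // -sm.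
  by rewrite (permPr (perm_to_rem im)) perm_cons.
by case: (boolP (perm_eq _ _)) => // /perm_mem /(_ i); rewrite in_cons eqxx im.
Qed.

Definition Phi m (g : 'S_n) b : C := phi m b.1 * (b.2 == g)%:R.

Lemma sum_pick (T : finType) (F : T -> C) (k : T) :
  \sum_l F l * (l == k)%:R = F k.
Proof.
rewrite (bigD1 k) //= eqxx mulr1 big1 ?addr0 // => l /negPf ->.
by rewrite mulr0.
Qed.

Lemma sum_kLa (F : 'I_n -> C) i j :
  \sum_k kLa a 1%g i j k * F k = a * (F i - F j).
Proof.
rewrite -(sum_pick F i) -(sum_pick F j) -sumrB big_distrr.
by apply: eq_bigr => k _ /=; rewrite /kLa eqxx; ring.
Qed.

Lemma lin_kappa_Lie (f : basis -> C) i j :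
  lin f (kappa_elt (kLa a) (@kC0 C n) i j) =
  a * (f ([:: i], 1%g) - f ([:: j], 1%g)).
Proof.
rewrite lin_kappa (bigD1 1%g) //= [X in _ + X]big1 ?addr0 => [|g /negPf g1]; last first.
  by rewrite /kLa g1 /kC0 mul0r addr0 big1 // => k _; rewrite mul0r.
by rewrite /kC0 mul0r addr0 sum_kLa.
Qed.

Lemma Phi_ideal m g z : in_ideal (kLa a) (@kC0 C n) z -> lin (Phi m g) z = 0.
Proof.
apply: in_ideal_lin0 => i j [u g1] [v g2].
rewrite lin_relator lin_kappa_Lie /Phi /mulb /=.
(* The group element [g1] on the left turns the relator of [i], [j] into that of [g1 i], [g1 j], and
   all its terms carry the same group element; so [phi_rel] applies. *)
rewrite -!catA /= -mulrBl -mulrBl phi_rel -mulrA -mulrBl.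
by rewrite mulrBl mulrA subrr.
Qed.

(** On [F_d] the functional [Phi w g] with [size w = d] sees only words of length [d], where it
    agrees with the symbol coefficient; yet it kills the ideal. *)
Lemma ideal_symbol0 d z w g : in_ideal (kLa a) (@kC0 C n) z -> tdeg_le d z ->
  size w = d -> scoef z w g = 0.
Proof.
move=> zI dz sw; rewrite -(Phi_ideal w g zI) scoefE [LHS](lin_deg_le _ dz) [RHS](lin_deg_le _ dz).
apply: eq_lin => -[v h] /=; rewrite /Phi /=; case: leqP; rewrite ?mul0r //.
rewrite leq_eqVlt => /orP[/eqP sv|lt].
  by rewrite phi_top ?sv ?sw // -!natrM !mulnb.
rewrite phi_small ?sw // mul0r; case: (boolP (perm_eq _ _)) => [/perm_size E|//].
by move: lt; rewrite E sw ltnn.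
Qed.

(** * Reordering words modulo [F_(d-1) T + I] *)

Definition negligible kL kC d x : Prop :=
  exists y z, [/\ tdeg_lt d y, in_ideal kL kC z & teq x (eadd y z)].

Lemma negligible_teq kL kC d x y :
  teq x y -> negligible kL kC d x -> negligible kL kC d y.
Proof.
move=> E [y1 [z [dy zI /teqP E1]]]; exists y1, z; split=> //.
by apply/teqP => f; move/teqP: E => <-.
Qed.

Lemma negligibleD kL kC d x y : negligible kL kC d x -> negligible kL kC d y ->
  negligible kL kC d (eadd x y).
Proof.
move=> [y1 [z1 [/tdeg_ltP d1 I1 /teqP E1]]] [y2 [z2 [/tdeg_ltP d2 I2 /teqP E2]]].
exists (eadd y1 y2), (eadd z1 z2); split; last 1 first.
- by apply/teqP => f; rewrite !lin_add E1 E2 !lin_add addrACA.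
- by apply/tdeg_ltP => f f0; rewrite lin_add d1 // d2 // addr0.
- exact: in_idealD.
Qed.

Lemma negligibleZ kL kC d (k : C) x :
  negligible kL kC d x -> negligible kL kC d (escale k x).
Proof.
move=> [y [z [/tdeg_ltP dy zI /teqP E]]].
exists (escale k y), (escale k z); split; last 1 first.
- by apply/teqP => f; rewrite lin_scale E !lin_add !lin_scale mulrDr.
- by apply/tdeg_ltP => f f0; rewrite lin_scale dy // mulr0.
- exact: in_idealZ.
Qed.

Lemma negligible_low kL kC d x : tdeg_lt d x -> negligible kL kC d x.
Proof.
move=> dx; exists x, [::]; split=> //; first exact: in_ideal0.
by apply/teqP => f; rewrite lin_add lin_nil addr0.
Qed.

Lemma negligible0 kL kC d : negligible kL kC d [::].
Proof.
by apply: negligible_low; apply/tdeg_ltP => f _; rewrite lin_nil.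
Qed.

Lemma negligible_trans kL kC d y x z : negligible kL kC d (esub x y) ->
  negligible kL kC d (esub y z) -> negligible kL kC d (esub x z).
Proof.
move=> xy yz; apply: negligible_teq (negligibleD xy yz).
by apply/teqP => f; rewrite lin_add !lin_sub addrA subrK.
Qed.

Lemma negligible_swap kL kC u i j v g :
  negligible kL kC (size u + size v).+2
    (esub (ebasis C (u ++ i :: j :: v) g) (ebasis C (u ++ j :: i :: v) g)).
Proof.
pose x k := emul (emul (ebasis C u 1%g) k) (ebasis C v g).
have Ex k f : lin f (x k) = lin (fun r => f (mulb (mulb (u, 1%g) r) (v, g))) k.
  by rewrite !lin_mul lin_basis; apply: eq_lin => r; rewrite lin_basis.
(* The difference of the two words is the relator plus kappa, placed between [u] and [v]; the kappa
   part has length at most [size u + size v + 1]. *)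
exists (x (kappa_elt kL kC i j)), (x (relator kL kC i j)).
have id1 s : [seq (1%g : 'S_n) l | l <- s] = s.
  by rewrite -[RHS]map_id; apply: eq_map => l; rewrite perm1.
split; last 1 first.
- apply/teqP => f; rewrite lin_add lin_sub !lin_basis !Ex lin_relator.
  by rewrite [RHS]addrC subrK /mulb /= /gcomp !mulg1 !id1 !perm1 -!catA.
- apply/tdeg_leP => f f0; rewrite Ex lin_kappa big1 // => h _.
  rewrite f0 ?mulr0 ?addr0; last first.
    by rewrite /mulb /= !size_cat !size_map addn0 ltnW.
  rewrite big1 // => k _; rewrite f0 ?mulr0 //.
  by rewrite /mulb /= !size_cat !size_map /= addn1 addSn.
- exact: in_ideal_rel.
Qed.

Lemma negligible_move kL kC u i p v g :
  negligible kL kC (size (u ++ i :: p ++ v))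
    (esub (ebasis C (u ++ i :: p ++ v) g) (ebasis C (u ++ p ++ i :: v) g)).
Proof.
elim: p u => [|j p IH] u /=.
  apply: negligible_teq (negligible0 _ _ _).
  by apply/teqP => f; rewrite lin_sub subrr lin_nil.
apply: (negligible_trans (y := ebasis C (u ++ j :: i :: p ++ v) g)).
  by rewrite size_cat /= !addnS; apply: negligible_swap.
by have := IH (rcons u j); rewrite !cat_rcons !size_cat /= !size_cat.
Qed.

Lemma negligible_perm kL kC u w v g : perm_eq w v ->
  negligible kL kC (size (u ++ w)) (esub (ebasis C (u ++ w) g) (ebasis C (u ++ v) g)).
Proof.
elim: w u v => [|i w IH] u v.
  rewrite perm_sym => /perm_nilP ->; apply: negligible_teq (negligible0 _ _ _).
  by apply/teqP => f; rewrite lin_sub subrr lin_nil.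
move=> pwv; have iv : i \in v by rewrite -(perm_mem pwv) in_cons eqxx.
case/splitPr: iv pwv => p1 p2 pwv.
have {}pwv : perm_eq w (p1 ++ p2).
  by rewrite -(perm_cons i) (permPl pwv) -cat1s perm_catCA.
apply: (negligible_trans (y := ebasis C (u ++ i :: p1 ++ p2) g)).
  by have := IH (rcons u i) _ pwv; rewrite !cat_rcons.
have -> : size (u ++ i :: w) = size (u ++ i :: p1 ++ p2).
  by rewrite !size_cat /= (perm_size pwv) size_cat.
exact: negligible_move.
Qed.

(** * The symbol map and the graded isomorphism it induces *)

Definition symb d x : elt := [seq t <- x | size t.2.1 == d].

Lemma lin_symb d f x :
  lin f (symb d x) = lin (fun b => (size b.1 == d)%:R * f b) x.
Proof. exact: (lin_filter f (fun b => size b.1 == d)). Qed.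

Lemma scoef_symb d x w g : scoef (symb d x) w g = if size w == d then scoef x w g else 0.
Proof.
rewrite !scoefE lin_symb; case: eqP => sw; last first.
  rewrite -[RHS](lin0 x); apply: eq_lin => -[v h] /=; case: (boolP (perm_eq _ _)) => [/perm_size ->|].
    by case: eqP => //; rewrite mul0r.
  by rewrite mulr0.
apply: eq_lin => -[v h] /=; case: (boolP (perm_eq _ _)) => [/perm_size ->|].
  by rewrite sw eqxx mul1r.
by rewrite mulr0.
Qed.

Definition normal w : word := sort (fun i j : 'I_n => (i <= j)%N) w.

Lemma perm_normal w v : perm_eq w v = (normal w == normal v).
Proof.
apply/idP/eqP => [|E]; last by rewrite -(perm_sort (fun i j : 'I_n => (i <= j)%N)) [sort _ _]E perm_sort.
apply/perm_sortP.
- by move=> i j; apply: leq_total.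
- by move=> i j k; apply: leq_trans.
- by move=> i j ij; apply/val_inj/anti_leq.
Qed.

(** This inclusion holds for every kappa: sorting the words of the top part costs only negligible
    terms, and the sorted top part has the symbol coefficients of [x] as its coefficients, hence
    vanishes. *)
Lemma symbol0_negligible kL kC d x : tdeg_le d x ->
  seq_S (symb d x) [::] -> negligible kL kC d x.
Proof.
move=> dx s0.
pose nf y : elt := [seq (t.1, (normal t.2.1, t.2.2)) | t <- y].
have nf0 : teq (nf (symb d x)) [::].
  apply/teqP => f; rewrite lin_nil.
  pose F : basis -> C := fun b => f (normal b.1, b.2).
  have -> : lin f (nf (symb d x)) = lin F (symb d x) by rewrite /lin big_map.
  have : forall y, seq_S y [::] -> lin F y = 0.
    move=> y y0.
    pose s := undup [seq (normal t.2.1, t.2.2) | t <- y].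
    have -> : lin F y = \sum_(b <- s) scoef y b.1 b.2 * f b.
      under eq_bigr => b _ do rewrite scoefE.
      rewrite /lin; under [RHS]eq_bigr do rewrite big_distrl.
      rewrite exchange_big /= !big_seq; apply: eq_bigr => t ty.
      have ts : (normal t.2.1, t.2.2) \in s.
        by rewrite mem_undup; apply: (map_f (fun t => (normal t.2.1, t.2.2)) ty).
      rewrite (bigD1_seq _ ts) ?undup_uniq //= perm_sym perm_sort perm_refl eqxx mulr1.
      rewrite big_seq_cond big1 ?addr0 // => -[w h] /andP[].
      rewrite mem_undup => /mapP[t' _ [-> ->]] /=; rewrite xpair_eqE.
      rewrite perm_sym perm_sort perm_sym perm_normal [normal t'.2.1 == _]eq_sym [t'.2.2 == _]eq_sym.
      by move=> /negPf->; rewrite mulr0 mul0r.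
    by rewrite big1 // => b _; rewrite y0 /scoef big_nil mul0r.
  exact.
have step y : all (fun t => size t.2.1 == d) y -> negligible kL kC d (esub y (nf y)).
  elim: y => [_|[k [w g]] y IH /= /andP[/eqP sw /IH {}IH]].
    exact: negligible0.
  have pw : perm_eq w (normal w) by rewrite perm_sym perm_sort perm_refl.
  have := negligible_perm kL kC [::] g pw; rewrite /= sw => N.
  apply: negligible_teq (negligibleD (negligibleZ k N) IH); apply/teqP => f.
  rewrite lin_add lin_scale !lin_sub !lin_basis !lin_cons /=; ring.
have lowx : tdeg_lt d [seq t <- x | (size t.2.1 < d)%N].
  apply/tdeg_ltP => f f0; rewrite (lin_filter f (fun b => size b.1 < d)%N).
  rewrite -[RHS](lin0 x); apply: eq_lin => b.
  by case: ltnP => [/f0->|]; rewrite ?mulr0 ?mul0r.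
(* Modulo [teq], [x] is its part below degree [d] plus [symb d x], and subtracting [nf (symb d x)]
   changes nothing since it is zero. *)
apply: negligible_teq (negligibleD (negligible_low kL kC lowx) (step (symb d x) (filter_all _ _))).
apply/teqP => f; rewrite lin_add lin_sub lin_symb (lin_filter f (fun b => size b.1 < d)%N).
move/teqP: nf0 => ->; rewrite lin_nil subr0 [RHS](lin_deg_le _ dx).
rewrite /lin -big_split /=; apply: eq_bigr => t _.
by rewrite -mulrDr -mulrDl -natrD; case: ltngtP.
Qed.

Theorem Lie_DOA : DOA (@kLa C n a) (@kC0 C n).
Proof.
exists symb; split; [|split; [|split; [|split; [|split; [|split]]]]].
- by move=> d x _ w g /negPf sw; rewrite scoef_symb sw.
- by move=> d x y _ _ w g; rewrite /symb /eadd filter_cat.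
- by move=> d k x _ w g; rewrite /symb /escale filter_map.
(* The kernel condition: one inclusion is reordering; in the other, [z] equals [x - y], so it has
   degree at most [d] and its symbol vanishes by [ideal_symbol0]. *)
- move=> d x dx; split; first exact: symbol0_negligible.
  move=> [y [z [/tdeg_ltP dy zI /teqP E]]] w g; rewrite scoef_symb.
  rewrite [RHS]/scoef big_nil; case: eqP => // sw.
  rewrite scoefE E lin_add dy ?add0r => [|b lt]; last first.
    by case: (boolP (perm_eq _ _)) => // /perm_size E'; move: lt; rewrite E' sw ltnn.
  rewrite -scoefE; apply: (ideal_symbol0 _ zI _ sw); apply/tdeg_leP => f f0.
  have -> : lin f z = lin f x - lin f y by rewrite E lin_add addrC addKr.
  move/tdeg_leP: dx => ->// ; rewrite dy ?subr0 // => b /ltnW; exact: f0.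
- move=> d y hy; exists (symb d y); split.
    apply/tdeg_leP => f f0; rewrite lin_symb -[RHS](lin0 y); apply: eq_lin => b.
    by case: eqP => [e|]; rewrite ?mul0r // f0 ?mulr0 // e.
  move=> w g; rewrite !scoef_symb; case: eqP => // /eqP sw; by rewrite hy.
- move=> d e x y dx dy w g; rewrite scoef_symb !scoefE !lin_mul lin_symb.
  under [RHS]eq_lin do rewrite lin_symb.
  case: eqP => sw; last first.
    symmetry; rewrite -[RHS](lin0 x); apply: eq_lin => b; case: eqP => sb; rewrite ?mul0r //.
    rewrite mul1r -[RHS](lin0 y); apply: eq_lin => c; case: eqP => sc; rewrite ?mul0r //.
    case: (boolP (perm_eq _ _)) => [/perm_size E|]; rewrite ?mulr0 //.
    by case: sw; rewrite -E /mulb /= size_cat size_map sb sc.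
  (* A product reaches length [d + e] only when both factors have their maximal lengths. *)
  rewrite (lin_deg_le _ dx); apply: eq_lin => b.
  rewrite (lin_deg_le _ dy).
  case: (ltngtP (size b.1) d) => sb; rewrite ?mul0r ?mul1r //; last first.
    apply: eq_lin => c; case: (ltngtP (size c.1) e) => sc; rewrite ?mul0r ?mul1r //.
    case: (boolP (perm_eq _ _)) => [/perm_size|//]; rewrite sw /mulb /= size_cat size_map sb.
    by move=> /addnI E; rewrite E ltnn in sc.
  rewrite -[RHS](lin0 y); apply: eq_lin => c; case: leqP => sc; rewrite ?mul0r ?mul1r //.
  case: (boolP (perm_eq _ _)) => [/perm_size|//]; rewrite sw /mulb /= size_cat size_map => E.
  by have := leq_add sb sc; rewrite addSn E ltnn.
- by move=> w g; rewrite /symb /eone /=.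
Qed.

End PBW.

(** Pointwise equal cochains have literally equal relator lists, which avoids function
    extensionality. *)
Lemma DOA_ext (C : numClosedFieldType) (n : nat) (kL kL' : 'S_n -> 'I_n -> 'I_n -> 'I_n -> C)
    (kC kC' : 'S_n -> 'I_n -> 'I_n -> C) :
  (forall g i j k, kL' g i j k = kL g i j k) -> (forall g i j, kC' g i j = kC g i j) ->
  DOA kL kC -> DOA kL' kC'.
Proof.
move=> EL EC.
have Er i j : relator kL' kC' i j = relator kL kC i j.
  rewrite /relator /kappa_elt; congr (esub _ (_ ++ _)).
    congr flatten; apply: eq_map => g; apply: eq_map => k; by rewrite EL.
  by apply: eq_map => g; rewrite EC.
have EI x : in_ideal kL' kC' x <-> in_ideal kL kC x.
  split=> -[s H]; exists s; move: H; congr (teq _ (esum _)).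
    by apply: eq_map => p; rewrite Er.
  by apply: eq_map => p; rewrite Er.
move=> [psi [H1 [H2 [H3 [H4 H5]]]]]; exists psi; do 4?[split=> //].
move=> d x /H4[K1 K2]; split=> [/K1|] [y [z [dy zI E]]]; last apply: K2.
  by exists y, z; split=> //; apply/EI.
by exists y, z; split=> //; apply/EI.
Qed.

(** * The ideal of a Drinfeld orbifold algebra in degrees 0 and 1 *)

Section Converse.
Variables (C : numClosedFieldType) (n : nat).
Variables (kL : 'S_n -> 'I_n -> 'I_n -> 'I_n -> C) (kC : 'S_n -> 'I_n -> 'I_n -> C).
Notation word := (seq 'I_n).
Notation basis := (seq 'I_n * 'S_n)%type.
Notation elt := (elt C n).
Implicit Types (x y z : elt) (b c : basis).

(* [psi d] induces a surjection from the span of the words of length [d] to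
   [(S(V)#G)_d]; for [d <= 1] both have the same dimension, so it is bijective. *)
Lemma ideal_deg_drop d z : DOA kL kC -> (d <= 1)%N -> in_ideal kL kC z ->
  tdeg_le d z -> tdeg_lt d z.
Proof.
move=> [psi [psiH [psiD [psiZ [psiK [psiS _]]]]]] d1 zI dz.
have scoef0 (w : word) g : scoef ([::] : elt) w g = 0 by rewrite scoefE lin_nil.
have psi_low x w g : tdeg_lt d x -> scoef (psi d x) w g = 0.
  move=> dx; rewrite -(scoef0 w g); apply/(proj2 (psiK d x _)).
    apply/tdeg_leP => f f0; move/tdeg_ltP: dx => -> // b /ltnW; exact: f0.
  exists x, [::]; split=> //; first exact: in_ideal0.
  by apply/teqP => f; rewrite lin_add lin_nil addr0.
have nil_lt : tdeg_lt d ([::] : elt) by apply/tdeg_ltP => f _; rewrite lin_nil.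
(* The map [psi d] acts on lists; its compatibility with [teq] follows because the difference of
   equal elements lies in the kernel. *)
have psi_teq x y w g : tdeg_le d x -> teq x y -> scoef (psi d x) w g = scoef (psi d y) w g.
  move=> dx /teqP E.
  have dy : tdeg_le d y by apply/tdeg_leP => f f0; rewrite -E; move: f f0; apply/tdeg_leP.
  have dN : tdeg_le d (escale (-1) y).
    by apply/tdeg_leP => f f0; rewrite lin_scale (proj2 (tdeg_leP d y)) ?mulr0.
  have := psi_low (esub x y) w g.
  rewrite psiD // scoefE lin_add -!scoefE psiZ // scoefE [in X in _ + X]scoefE.
  rewrite lin_scale -!scoefE mulN1r => /(_ _)/subr0_eq; apply.
  by apply/tdeg_ltP => f _; rewrite lin_sub E subrr.
pose F w g b := (size b.1 == d)%:R * scoef (psi d (ebasis C b.1 b.2)) w g.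
have basis_le b : (size b.1 <= d)%N -> tdeg_le d (ebasis C b.1 b.2).
  by move=> db; apply/tdeg_leP => f f0; rewrite lin_basis f0.
have psi_lin x w g : tdeg_le d x -> scoef (psi d x) w g = lin (F w g) x.
  move=> dx; pose x' := [seq t <- x | (size t.2.1 <= d)%N].
  have Ex : teq x x'.
    apply/teqP => f; rewrite (lin_deg_le _ dx).
    by rewrite (lin_filter f (fun b => size b.1 <= d)%N).
  rewrite (psi_teq _ _ _ _ dx Ex); move/teqP: Ex => ->.
  have := filter_all (fun t : C * basis => size t.2.1 <= d)%N x; rewrite -/x'.
  elim: x' => [_|[k [v h]] y IH /= /andP[sv ally]].
    by rewrite lin_nil psi_low.
  have -> : (k, (v, h)) :: y = eadd (escale k (ebasis C v h)) y.
    by rewrite /eadd /= mulr1.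
  have dy : tdeg_le d y.
    apply/tdeg_leP => f f0; rewrite /lin big_seq big1 // => t ty.
    by rewrite f0 ?mulr0 // (allP ally).
  have db := basis_le (v, h) sv.
  have dk : tdeg_le d (escale k (ebasis C v h)).
    by apply/tdeg_leP => f f0; rewrite lin_scale lin_basis f0 ?mulr0.
  rewrite psiD // scoefE !lin_add -!scoefE IH // psiZ // scoefE !lin_scale.
  rewrite -scoefE lin_basis /F /=; congr (_ * _ + _).
  move: sv; rewrite leq_eqVlt => /orP[->|lt]; first by rewrite mul1r.
  rewrite psi_low ?mulr0 //; apply/tdeg_ltP => f f0.
  by rewrite lin_basis f0.
pose J := (d.-tuple 'I_n * 'S_n)%type.
pose N := #|{: J}|.
pose e (i : 'I_N) : basis := (val (enum_val i).1, (enum_val i).2).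
have e_inj : injective e.
  move=> i j [E1 E2]; apply/enum_val_inj/eqP; rewrite -pair_eqE /= /pair_eq.
  by rewrite E2 eqxx andbT; apply/eqP/val_inj.
have size_e i : size (e i).1 = d by rewrite size_tuple.
have e_surj b : size b.1 == d -> exists i, e i = b.
  move=> sb; exists (enum_rank ((Tuple sb, b.2) : J)).
  by rewrite /e enum_rankK /= -surjective_pairing.
have uniq_e : uniq (map e (enum 'I_N)).
  by rewrite (map_inj_uniq e_inj) enum_uniq.
have F_coef x w g : lin (F w g) x = \sum_i coef x (e i).1 (e i).2 * F w g (e i).
  rewrite (lin_coef uniq_e) => [|t _ nt]; first by rewrite big_map big_enum.
  rewrite /F; case: eqP => [/eqP/e_surj[i ei]|_]; last by rewrite mul0r.
  by move: nt; rewrite -ei map_f ?mem_enum.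
have /fin_all_exists[X HX] (i : 'I_N) : exists x, tdeg_le d x /\
    seq_S (psi d x) (ebasis C (e i).1 (e i).2).
  apply: psiS => w g sw; rewrite scoefE lin_basis /=.
  case: (boolP (perm_eq _ _)) => // /perm_size E.
  by move: sw; rewrite -E size_e eqxx.
(* [B] is the matrix of [psi d] on words of length [d], and the rows of [A] are preimages of the
   basis supplied by surjectivity. Being square, [A *m B = 1] makes [B] invertible. *)
pose A := \matrix_(i < N, j < N) coef (X i) (e j).1 (e j).2.
pose B := \matrix_(i < N, j < N) F (e j).1 (e j).2 (e i).
have AB : A *m B = 1%:M.
  apply/matrixP => i j; rewrite !mxE.
  have [dX EX] := HX i; have := EX (e j).1 (e j).2.
  rewrite psi_lin // F_coef scoefE lin_basis => H.
  under eq_bigr do rewrite !mxE.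
  rewrite H -(inj_eq e_inj); move: (size_e i); case: (e i) (e j) => v g [w h] /= sv.
  rewrite xpair_eqE; congr ((_ && _)%:R).
  (* Words of length at most 1 that are permutations of each other are equal; this is where [d <= 1]
     enters. *)
  by apply/idP/eqP => [pw|->//]; apply: perm_small_eq (pw); rewrite -(perm_size pw) sv.
have Bz : \row_i coef z (e i).1 (e i).2 *m B = 0.
  apply/rowP => j; rewrite !mxE; under eq_bigr do rewrite !mxE.
  rewrite -F_coef -psi_lin // -(scoef0 (e j).1 (e j).2).
  apply/(proj2 (psiK d z dz)); by exists [::], z; split.
have z0 : \row_i coef z (e i).1 (e i).2 = 0.
  by rewrite -[LHS]mulmx1 -(mulmx1C AB) mulmxA Bz mul0mx.
apply/tdeg_ltP => f f0; rewrite (lin_deg_le _ dz).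
rewrite (lin_coef uniq_e) => [|t _ nt].
  rewrite big_map big1 // => i _; move/rowP/(_ i): z0; rewrite !mxE => ->.
  by rewrite mul0r.
case: (ltngtP (size t.2.1) d) => st; rewrite ?mul0r ?mul1r ?f0 //.
by move/eqP/e_surj: st nt => [i <-]; rewrite map_f ?mem_enum.
Qed.

(** The degree drops twice: [tdeg_lt 1] is [tdeg_le 0], and [tdeg_lt 0] is equality with zero. *)
Lemma DOA_ideal_deg1 z : DOA kL kC -> in_ideal kL kC z -> tdeg_le 1 z -> teq z [::].
Proof.
by move=> D zI /(ideal_deg_drop D (leqnn 1) zI) /(ideal_deg_drop D (leq0n 1) zI).
Qed.

Lemma DOA_lin0 z : DOA kL kC -> in_ideal kL kC z ->
  (forall f, (forall b, (size b.1 <= 1)%N -> f b = 0) -> lin f z = 0) ->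
  forall f, lin f z = 0.
Proof.
by move=> D zI /tdeg_leP /(DOA_ideal_deg1 D zI) /teqP E f; rewrite E lin_nil.
Qed.

Lemma lin_kappa_deg f i j : (forall b, (size b.1 <= 1)%N -> f b = 0) ->
  lin f (kappa_elt kL kC i j) = 0.
Proof.
move=> f0; rewrite lin_kappa big1 // => g _.
by rewrite f0 // mulr0 addr0 big1 // => k _; rewrite f0 // mulr0.
Qed.

(** * Invariance of kappa under the group *)

Hypothesis D : DOA kL kC.

(** With the composition order of [gcomp], [b.2 ^ g] is g h g^-1 for h = [b.2], so this is
    conjugation by g in T(V)#G. *)
Definition conj_basis (g : 'S_n) b : basis := ([seq g i | i <- b.1], (b.2 ^ g)%g).

(** The conjugate of one relator and the relator of [g i], [g j] have the same quadratic part; their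
    difference is an ideal element of degree at most 1, hence zero. *)
Lemma kappa_conj (g : 'S_n) i j f :
  lin f (kappa_elt kL kC (g i) (g j)) = lin (f \o conj_basis g) (kappa_elt kL kC i j).
Proof.
pose z := esub (emul (emul (ebasis C [::] g) (relator kL kC i j)) (ebasis C [::] g^-1))
  (relator kL kC (g i) (g j)).
have Ez f' : lin f' z = lin f' (kappa_elt kL kC (g i) (g j)) -
    lin (f' \o conj_basis g) (kappa_elt kL kC i j).
  rewrite lin_sub (lin_rel_basis _ ([::], g) _ _ _ _ ([::], g^-1%g)).
  rewrite (@eq_lin _ _ _ (f' \o conj_basis g)) => [|[w h]]; last first.
    by rewrite /mulb /conj_basis /gcomp /= cats0 conjgE.
  rewrite !lin_relator /= /conj_basis /= conj1g; ring.
apply/eqP; rewrite -subr_eq0 -Ez; apply/eqP; apply: (DOA_lin0 D).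
  apply: in_idealD; first exact: in_ideal_rel.
  apply: in_idealZ.
  apply: in_ideal_teq (in_ideal_rel _ _ (eone C n) _ _ (eone C n)).
  apply/teqP => f'; rewrite (lin_rel_basis _ ([::], 1%g) _ _ _ _ ([::], 1%g)).
  by apply: eq_lin => b; rewrite mulb1l mulb1r.
move=> f' f0; rewrite Ez !lin_kappa_deg ?subrr // => b sb /=.
by rewrite f0 // size_map.
Qed.

Lemma lin_kappa_delta1 i j k g :
  lin (delta C ([:: k], g)) (kappa_elt kL kC i j) = kL g i j k.
Proof.
rewrite lin_kappa (bigD1 g) //= [X in _ + X]big1 ?addr0 => [|h /negPf hg]; last first.
  rewrite /delta !xpair_eqE /= mulr0 addr0 big1 // => l _.
  by rewrite xpair_eqE hg andbF mulr0.
rewrite {2}/delta xpair_eqE /= mulr0 addr0 -[RHS](sum_pick (kL g i j)).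
by apply: eq_bigr => l _; rewrite /delta xpair_eqE eqxx andbT eqseq_cons andbT.
Qed.

Lemma lin_kappa_delta0 i j g :
  lin (delta C ([::], g)) (kappa_elt kL kC i j) = kC g i j.
Proof.
rewrite lin_kappa -[RHS](sum_pick (fun h => kC h i j)); apply: eq_bigr => h _.
rewrite /delta xpair_eqE eqxx big1 ?add0r // => k _.
by rewrite xpair_eqE mulr0.
Qed.

Lemma delta_conj (g h : 'S_n) w :
  delta C ([seq g i | i <- w], (h ^ g)%g) \o conj_basis g =1 delta C (w, h).
Proof.
move=> [v k]; rewrite /delta /conj_basis /= !xpair_eqE (inj_eq (conjg_inj g)).
by rewrite (inj_eq (inj_map (@perm_inj _ g))).
Qed.

Lemma kL_inv (g h : 'S_n) i j k : kL (h ^ g) (g i) (g j) (g k) = kL h i j k.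
Proof.
rewrite -lin_kappa_delta1 kappa_conj -[RHS]lin_kappa_delta1; apply: eq_lin.
exact: (delta_conj g h [:: k]).
Qed.

Lemma kC_inv (g h : 'S_n) i j : kC (h ^ g) (g i) (g j) = kC h i j.
Proof.
rewrite -lin_kappa_delta0 kappa_conj -[RHS]lin_kappa_delta0; apply: eq_lin.
exact: (delta_conj g h [::]).
Qed.

(** * The Jacobi identity *)

Hypothesis S : supp_id kL.

Lemma lin_kappa_supp f i j : lin f (kappa_elt kL kC i j) =
  \sum_k kL 1%g i j k * f ([:: k], 1%g) + \sum_g kC g i j * f ([::], g).
Proof.
rewrite lin_kappa big_split (bigD1 1%g) //= [X in _ + X + _]big1 ?addr0 // => g g1.
by rewrite big1 // => k _; rewrite S // mul0r.
Qed.

(** The commutator [e_u, r_vw] contains the quadratic terms -[e_u, kappa^L(v, w)]; adding multiples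
    of the relators r_uk trades them for terms of degree at most 1. *)
Definition bracket_relator (u v w : 'I_n) : elt :=
  esub (eadd (emul (emul (ebasis C [:: u] 1%g) (relator kL kC v w)) (eone C n))
    (esum [seq escale (kL 1%g v w k)
            (emul (emul (eone C n) (relator kL kC u k)) (eone C n)) | k <- enum 'I_n]))
    (emul (emul (eone C n) (relator kL kC v w)) (ebasis C [:: u] 1%g)).

Lemma in_ideal_bracket (u v w : 'I_n) : in_ideal kL kC (bracket_relator u v w).
Proof.
apply: in_idealD; last by apply: in_idealZ; apply: in_ideal_rel.
apply: in_idealD; first exact: in_ideal_rel.
by apply: in_ideal_sum => k; apply: in_idealZ; apply: in_ideal_rel.
Qed.

Lemma lin_bracket f (u v w : 'I_n) : lin f (bracket_relator u v w) =
  f ([:: u; v; w], 1%g) - f ([:: u; w; v], 1%g)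
  - f ([:: v; w; u], 1%g) + f ([:: w; v; u], 1%g)
  - \sum_k kL 1%g v w k * lin f (kappa_elt kL kC u k)
  - \sum_g kC g v w * (f ([:: u], g) - f ([:: g u], g)).
Proof.
have Es : lin f (esum [seq escale (kL 1%g v w k)
      (emul (emul (eone C n) (relator kL kC u k)) (eone C n)) | k <- enum 'I_n]) =
    \sum_k (kL 1%g v w k * f ([:: u; k], 1%g) - kL 1%g v w k * f ([:: k; u], 1%g)
    - kL 1%g v w k * lin f (kappa_elt kL kC u k)).
  rewrite lin_sum big_map big_enum; apply: eq_bigr => k _.
  rewrite lin_scale (lin_rel_basis _ ([::], 1%g) _ _ _ _ ([::], 1%g)).
  under eq_lin do rewrite mulb1l mulb1r.
  by rewrite lin_relator !mulrBr.
rewrite lin_sub lin_add Es.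
rewrite !sumrB (lin_rel_basis _ ([:: u], 1%g) _ _ _ _ ([::], 1%g)).
rewrite (lin_rel_basis _ ([::], 1%g) _ _ _ _ ([:: u], 1%g)).
have L1 : (fun r => f (mulb (mulb ([:: u], 1%g) r) ([::], 1%g))) =1
    fun b => f (u :: b.1, b.2).
  move=> [s g]; rewrite mulb1r /mulb /gcomp /= mulg1; congr (f (_ :: _, _)).
  by rewrite -[RHS]map_id; apply: eq_map => l; rewrite perm1.
have L2 : (fun r => f (mulb (mulb ([::], 1%g) r) ([:: u], 1%g))) =1
    fun b => f (rcons b.1 (b.2 u), b.2).
  by move=> [s g]; rewrite mulb1l /mulb /gcomp /= mul1g cats1.
rewrite (eq_lin _ L1) (eq_lin _ L2) !lin_relator.
rewrite [X in _ - X + _]lin_kappa_supp [X in _ - (_ - X) = _]lin_kappa_supp /= !perm1.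
under [X in _ = _ - X]eq_bigr do rewrite mulrBr.
rewrite [X in _ = _ - X]sumrB.
ring.
Qed.

(** In the cyclic sum of the [bracket_relator]s the cubic terms cancel; what remains lies in the
    ideal in degree at most 1, so it vanishes. *)
Lemma Jacobi f (u v w : 'I_n) :
  \sum_k kL 1%g v w k * lin f (kappa_elt kL kC u k)
  + \sum_g kC g v w * (f ([:: u], g) - f ([:: g u], g))
  + (\sum_k kL 1%g w u k * lin f (kappa_elt kL kC v k)
  + \sum_g kC g w u * (f ([:: v], g) - f ([:: g v], g)))
  + (\sum_k kL 1%g u v k * lin f (kappa_elt kL kC w k)
  + \sum_g kC g u v * (f ([:: w], g) - f ([:: g w], g))) = 0.
Proof.
pose z := eadd (eadd (bracket_relator u v w) (bracket_relator v w u))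
  (bracket_relator w u v).
have Ez f' : lin f' z = lin f' (bracket_relator u v w) +
    lin f' (bracket_relator v w u) + lin f' (bracket_relator w u v).
  by rewrite (lin_add _ (eadd _ _)) lin_add.
suff z0 : lin f z = 0.
  by rewrite -[RHS]oppr0 -[in RHS]z0 Ez !lin_bracket; ring.
apply: (DOA_lin0 D) => [|{}f f0].
  apply: in_idealD (in_ideal_bracket _ _ _).
  exact: in_idealD (in_ideal_bracket _ _ _) (in_ideal_bracket _ _ _).
have sum0 (i j k : 'I_n) : \sum_l kL 1%g i j l * lin f (kappa_elt kL kC k l) = 0.
  by rewrite big1 // => l _; rewrite lin_kappa_deg ?mulr0.
have sumC0 (i j k : 'I_n) : \sum_g kC g i j * (f ([:: k], g) - f ([:: g k], g)) = 0.
  by rewrite big1 // => g _; rewrite !f0 // subrr mulr0.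
by rewrite Ez !lin_bracket !sum0 !sumC0; ring.
Qed.

(** * Solving the invariance and Jacobi equations *)

Hypothesis alt : alternating kL kC.

Lemma eq_opp0 (k : C) : k = - k -> k = 0.
Proof.
by move/eqP; rewrite -addr_eq0 -mulr2n mulrn_eq0 => /eqP.
Qed.

(** Since S_n is 2-transitive, invariance leaves one value for the e_i coefficient of kappa^L(e_i,
    e_j), and alternation gives the opposite value for e_j. *)
Lemma kL_Lie i0 j0 : i0 != j0 ->
  forall g i j k, kL g i j k = kLa (kL 1%g i0 j0 i0) g i j k.
Proof.
move=> ij0 g i j k; rewrite /kLa; case: eqP => [->|/eqP/S->//].
have [altL _] := alt.
have [->|ij] := eqVneq i j; first by rewrite subrr mulr0 (eq_opp0 (altL _ _ _ _)).
have diag i' j' : i' != j' -> kL 1%g i' j' i' = kL 1%g i0 j0 i0.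
  move=> ij'; pose h : 'S_n := (tperm i0 i' * tperm (tperm i0 i' j0) j')%g.
  have hi : h i0 = i'.
    have ne : tperm i0 i' j0 != i'.
      by rewrite -{2}(tpermL i0 i') (inj_eq perm_inj) eq_sym.
    by rewrite permM tpermL (tpermD ne) // eq_sym.
  have hj : h j0 = j' by rewrite permM tpermL.
  by rewrite -[RHS](kL_inv h) hi hj conj1g.
have [->|ki] := eqVneq k i; first by rewrite (negPf ij) subr0 mulr1 diag.
have [->|kj] := eqVneq k j.
  by rewrite sub0r mulrN1 altL diag // eq_sym.
(* For a third index [k], the transposition of [i] and [j] fixes [k] and exchanges the arguments, so
   the coefficient is its own negative. *)
rewrite subrr mulr0; apply: eq_opp0.
rewrite -altL -(kL_inv (tperm i j)) conj1g tpermL tpermR tpermD // eq_sym //.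
Qed.

(* The constant part of the Jacobi identity makes [kC g] a coboundary
   [B u v = h v - h u]; the linear part says that [h w] is the midpoint of [h p]
   and [h (g p)] whenever [p] is moved by [g] and [w] is another index. *)
Lemma kC_eq0 (a : C) : a != 0 -> (forall g i j k, kL g i j k = kLa a g i j k) ->
  forall g i j, kC g i j = 0.
Proof.
move=> a0 kLE g; have [_ altC] := alt.
(* The coefficient of [g] in the Jacobi identity is [2 a] times this sum. *)
have coc u v w : kC g u v + kC g v w + kC g w u = 0.
  have := Jacobi (delta C ([::], g)) u v w.
  under eq_bigr do rewrite kLE lin_kappa_delta0.
  under [X in _ + (X + _) + _]eq_bigr do rewrite kLE lin_kappa_delta0.
  under [X in _ + (X + _) = _]eq_bigr do rewrite kLE lin_kappa_delta0.
  rewrite !sum_kLa.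
  have s0 i j k : \sum_h kC h i j *
      (delta C ([::], g) ([:: k], h) - delta C ([::], g) ([:: h k], h)) = 0.
    by rewrite big1 // => h _; rewrite /delta !xpair_eqE subrr mulr0.
  rewrite !s0 !addr0 (altC g u w) (altC g v u) (altC g w v) => E.
  apply/eqP; move/eqP: E.
  have -> : a * (kC g u v - - kC g w u) + a * (kC g v w - - kC g u v) +
     a * (kC g w u - - kC g v w) = (a *+ 2) * (kC g u v + kC g v w + kC g w u).
    by ring.
  by rewrite mulf_eq0 mulrn_eq0 (negPf a0).
have kk i : kC g i i = 0 by apply: eq_opp0.
have [->|g1] := eqVneq g 1%g.
  move=> i j; apply: eq_opp0; rewrite -altC -(kC_inv (tperm i j)) conj1g.
  by rewrite tpermL tpermR.
(* The coefficient of e_k g in the Jacobi identity; as [g] is not the identity, kappa^L contributes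
   nothing. *)
have deg1 u v w k :
    kC g v w * ((u == k)%:R - (g u == k)%:R) + kC g w u * ((v == k)%:R - (g v == k)%:R)
    + kC g u v * ((w == k)%:R - (g w == k)%:R) = 0.
  have := Jacobi (delta C ([:: k], g)) u v w.
  have s0 i j l : \sum_h kL 1%g i j h * lin (delta C ([:: k], g)) (kappa_elt kL kC l h) = 0.
    by rewrite big1 // => h _; rewrite lin_kappa_delta1 (S g1) mulr0.
  have s1 i j l : \sum_h kC h i j *
      (delta C ([:: k], g) ([:: l], h) - delta C ([:: k], g) ([:: h l], h)) =
      kC g i j * ((l == k)%:R - (g l == k)%:R).
    rewrite -(sum_pick (fun h => kC h i j * ((l == k)%:R - (h l == k)%:R)) g).
    apply: eq_bigr => h _; rewrite /delta !xpair_eqE !eqseq_cons !andbT.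
    by case: (h == g); rewrite ?andbT ?andbF ?subrr ?mulr1 ?mulr0.
  by rewrite !s0 !s1 !add0r.
have mid u p w : g p = u -> p != u -> w != u -> w != p -> kC g p w = kC g w u.
  move=> gp pu wu wp; have := deg1 u p w u.
  have gup : (g u == u) = false by rewrite -{2}gp (inj_eq perm_inj) eq_sym (negPf pu).
  have gwu : (g w == u) = false by rewrite -gp (inj_eq perm_inj) (negPf wp).
  rewrite eqxx gup gwu gp eqxx (negPf pu) (negPf wu) subrr mulr0 addr0 subr0 mulr1.
  by rewrite sub0r mulrN1 => /subr0_eq.
have [u gu] : exists u, g u != u.
  apply/existsP; apply: contraR g1 => /existsPn H; apply/eqP/permP => u.
  by rewrite perm1; apply/eqP; rewrite -[_ == _]negbK.
pose p := (g^-1)%g u; have gp : g p = u by rewrite permKV.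
have pu : p != u by rewrite -(inj_eq (@perm_inj _ g)) gp eq_sym.
(* If [g] swaps [p] and [u], invariance under [g] itself makes the value its own negative. Otherwise
   [q], [p], [u] are distinct, [mid] makes the three terms of the cocycle equal, and their sum is
   zero. *)
have pu0 : kC g p u = 0.
  have [gup|gup] := eqVneq (g u) p.
    apply: eq_opp0; rewrite -altC -[LHS](kC_inv g) gp gup.
    by rewrite conjgE mulKg.
  pose q := (g^-1)%g p; have gq : g q = p by rewrite permKV.
  have qu : q != u by apply: contraNneq gup => <-; rewrite gq.
  have qp : q != p by rewrite -(inj_eq (@perm_inj _ g)) gq gp.
  have E1 := mid u p q gp pu qu qp.
  have E2 : kC g q u = kC g u p by apply: mid => //; rewrite eq_sym.
  have := coc u p q; rewrite E1 E2 => /eqP.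
  have -> : kC g u p + kC g u p + kC g u p = kC g u p *+ 3 by ring.
  by rewrite mulrn_eq0 /= => /eqP E; rewrite altC E oppr0.
have wu0 w : kC g w u = 0.
  have [->|wu] := eqVneq w u; first exact: kk.
  have [->|wp] := eqVneq w p; first exact: pu0.
  (* With [kC g u p = 0] and [kC g p w = kC g w u], the cocycle identity reads
     [kC g w u + kC g w u = 0]. *)
  apply: eq_opp0; apply/eqP; rewrite -addr_eq0; apply/eqP.
  by have := coc u p w; rewrite (mid u p w) // altC pu0 oppr0 add0r.
move=> i j; have := coc u i j; rewrite wu0 addr0 altC wu0 oppr0 add0r; exact.
Qed.

End Converse.

Theorem theorem3p1 (C : numClosedFieldType) (n : nat) (hn : (3 <= n)%N) :
  (forall a : C, LieOrbifold (@kLa C n a) (@kC0 C n)) /\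
  (forall (kL : 'S_n -> 'I_n -> 'I_n -> 'I_n -> C) (kC : 'S_n -> 'I_n -> 'I_n -> C),
     alternating kL kC -> supp_id kL ->
     (exists g i j k, kL g i j k != 0) ->
     (DOA kL kC <->
      exists a : C, (forall g i j k, kL g i j k = kLa a g i j k) /\
                    (forall g i j, kC g i j = 0))).
Proof.
split=> [a|kL kC alt S [g [i [j [k nz]]]]].
  by split=> [|g /negPf g1 i j k]; [exact: Lie_DOA | rewrite /kLa g1].
split=> [D|[a [EL EC]]].
  have ij : i != j.
    apply: contraNneq nz => ->; apply/eqP/eq_opp0; exact: (proj1 alt).
  have EL := kL_Lie D S alt ij; exists (kL 1%g i j i); split=> //.
  (* If the parameter were zero, kappa^L would vanish, contrary to [nz]. *)
  apply: (kC_eq0 D S alt _ EL); apply: contraNneq nz => a0.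
  by rewrite EL a0 /kLa mul0r if_same.
apply: DOA_ext (Lie_DOA n a) => *; by rewrite ?EL ?EC.
Qed.
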